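(* Let $\widetilde U_k=M^{1/2}U_kL_k^{-1/2}$ and let $$\widetilde U_k=G\Sigma H^*,\qquad G\in\mathbb{C}^{N\times(k+1)},\quad H\in\mathbb{C}^{(k+1)\times(k+1)},\quad \Sigma\in\mathbb{R}^{(k+1)\times(k+1)}$$ be the singular value decomposition of $\widetilde U_k$; that is, $G=[\,g_0\,|\,g_1\,|\,\cdots\,|\,g_k\,]$ with $g_i^*g_j=\delta_{ij}$, $H=[\,h_0\,|\,h_1\,|\,\cdots\,|\,h_k\,]$ with $h_i^*h_j=\delta_{ij}$, and $\Sigma=\mathrm{diag}(\sigma_0,\sigma_1,\ldots,\sigma_k)$ with $\sigma_0\ge\sigma_1\ge\cdots\ge\sigma_k\ge 0$. Define $$u_{i,j}=(M^{1/2}g_i)^*u_{n+j}=g_i^*M^{1/2}u_{n+j},\qquad i=0,1,\ldots,k-1,\quad j=0,1,\ldots,k.$$ For scalars or vectors $v_0,\ldots,v_k$, let $$D(v_0,v_1,\ldots,v_k)=\begin{vmatrix} v_0 & v_1 & \cdots & v_k \\ {u}_{0,0} & u_{0,1} & \cdots & u_{0,k} \\ {u}_{1,0} & u_{1,1} & \cdots & u_{1,k} \\ \vdots & \vdots & & \vdots \\ {u}_{k-1,0} & u_{k-1,1} & \cdots & u_{k-1,k} \end{vmatrix},$$ where, when the $v_i$ are vectors, the determinant is defined via its expansion with respect to its first row. Let $c=[c_0,\ldots,c_k]^T=L_k^{-1/2}h_k$, and assume that $\sum_{j=0}^kc_j\ne0$ (so that the SVD-MPE approximation $s_{n,k}$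 exists) and that $D(1,1,\ldots,1)\ne0$. Then $s_{n,k}$ has the determinant representation $$s_{n,k}=\frac{D(x_n,x_{n+1},\ldots,x_{n+k})}{D(1,1,\ldots,1)}.$$
   Context: Let $\{x_m\}_{m\ge0}$ be a sequence of vectors in $\mathbb{C}^N$, and put $u_m=x_{m+1}-x_m$ (single-indexed vectors $u_m$ are not to be confused with the doubly-indexed scalars $u_{i,j}$ of the claim). For a fixed integer $n\ge0$ and an integer $k\ge1$ with $k+1\le N$, let $U_k=[\,u_n\,|\,u_{n+1}\,|\,\cdots\,|\,u_{n+k}\,]\in\mathbb{C}^{N\times(k+1)}$. Let $M\in\mathbb{C}^{N\times N}$ and $L_k\in\mathbb{C}^{(k+1)\times(k+1)}$ be hermitian positive definite, with hermitian positive definite square roots $M^{1/2}$, $L_k^{1/2}$, and $L_k^{-1/2}=(L_k^{1/2})^{-1}$. Norms: $\|a\|_M=\sqrt{a^*Ma}$ on $\mathbb{C}^N$, $\|a\|_{L_k}=\sqrt{a^*L_ka}$ on $\mathbb{C}^{k+1}$. SVD-MPE: with $h_k$ the right singular vector of $\widetilde U_k$ corresponding to its smallest singular value $\sigma_k$, the vector $c=[c_0,\ldots,c_k]^T=L_k^{-1/2}h_k$ is the optimal solution of $\min_c\|U_kc\|_M$ subject to $\|c\|_{L_k}=1$ used by the method. The SVD-MPE approximation is $s_{n,k}=\sum_{i=0}^k\gamma_ix_{n+i}$ with $\gamma_i=c_i/\sum_{j=0}^kc_j$, defined if and only if $\sum_{j=0}^kc_j\ne0$. *)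

(* Defs.v *)
From HB Require Import structures.
From mathcomp Require Import all_boot all_order all_algebra.
From mathcomp Require Import reals complex.

Set Implicit Arguments.
Unset Strict Implicit.
Unset Printing Implicit Defensive.

Import Order.TTheory GRing.Theory Num.Theory.
Local Open Scope ring_scope.
Local Open Scope sesquilinear_scope.
Local Open Scope complex_scope.

(* The order on R[i] is partial: 0 < z means that z is real and positive. *)
Definition hpd (R : realType) (d : nat) (A : 'M[R[i]]_d) : Prop :=
  A \is hermsymmx /\
  forall y : 'cV[R[i]]_d, y != 0 -> 0 < (y ^t* *m A *m y) 0 0.

Definition is_hpd_sqrt (R : realType) (d : nat) (A S : 'M[R[i]]_d) : Prop :=
  hpd S /\ S *m S = A.

Definition fdiff (R : realType) (N : nat) (x : nat -> 'cV[R[i]]_N) (m : nat) :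
    'cV[R[i]]_N :=
  x m.+1 - x m.

Definition fdiff_mx (R : realType) (N : nat) (x : nat -> 'cV[R[i]]_N)
    (n k : nat) : 'M[R[i]]_(N, k.+1) :=
  \matrix_(r, j) fdiff x (n + j)%N r 0.

(* Reduced singular value decomposition: G is rectangular with orthonormal
   columns, and sigma lists the singular values in nonincreasing order. *)
Definition is_svd (R : realType) (N p : nat) (A G : 'M[R[i]]_(N, p))
    (sigma : 'rV[R]_p) (H : 'M[R[i]]_p) : Prop :=
  [/\ G ^t* *m G = 1%:M,
      H ^t* *m H = 1%:M,
      forall j : 'I_p, 0 <= sigma 0 j,
      forall i j : 'I_p, (i <= j)%N -> sigma 0 j <= sigma 0 i
    & A = G *m map_mx (real_complex R) (diag_mx sigma) *m H ^t*].

(* The scalars u_(i,j) = (S g_i)^* u_(n+j), for i < k, where S is the square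
   root of M. *)
Definition proj_diff_mx (R : realType) (N : nat) (S : 'M[R[i]]_N) (k : nat)
    (G : 'M[R[i]]_(N, k.+1)) (x : nat -> 'cV[R[i]]_N) (n : nat) :
    'M[R[i]]_(k, k.+1) :=
  \matrix_(i < k, j < k.+1)
    ((S *m col (widen_ord (leqnSn k) i) G) ^t* *m fdiff x (n + j)%N) 0 0.

Definition mpe_approx (R : realType) (N : nat) (x : nat -> 'cV[R[i]]_N)
    (n k : nat) (c : 'cV[R[i]]_k.+1) : 'cV[R[i]]_N :=
  \sum_(i < k.+1) (c i 0 / \sum_(j < k.+1) c j 0) *: x (n + i)%N.

(* D(v_0, ..., v_k) for scalars v_j, W being the block of rows below the
   first one. *)
Definition Dscal (R : realType) (k : nat) (W : 'M[R[i]]_(k, k.+1))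
    (v : 'I_k.+1 -> R[i]) : R[i] :=
  \det (col_mx (\row_j v j) W : 'M[R[i]]_k.+1).

(* D(v_0, ..., v_k) for vectors v_j: expansion along the first row. These
   cofactors do not depend on the first row, so it is filled with zeros. *)
Definition Dvec (R : realType) (k : nat) (W : 'M[R[i]]_(k, k.+1)) (N : nat)
    (v : 'I_k.+1 -> 'cV[R[i]]_N) : 'cV[R[i]]_N :=
  \sum_(j < k.+1) cofactor (col_mx (0 : 'rV_k.+1) W : 'M[R[i]]_k.+1) ord0 j *: v j.

Lemma DvecE (R : realType) (k : nat) (W : 'M[R[i]]_(k, k.+1)) (N : nat)
    (v : 'I_k.+1 -> 'cV[R[i]]_N) (r : 'I_N) :
  Dvec W v r 0 = Dscal W (fun j => v j r 0).
Proof.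
rewrite /Dscal (expand_det_row _ (ord0 : 'I_k.+1)) /Dvec summxE.
apply: eq_bigr => j _; rewrite mxE mulrC; congr (_ * _).
  have -> : (ord0 : 'I_k.+1) = lshift k (ord0 : 'I_1) by apply: val_inj.
  by rewrite (@col_mxEu _ 1 k) mxE.
rewrite /cofactor; congr (_ * \det _); apply/matrixP=> a b; rewrite !mxE.
have -> : lift (ord0 : 'I_k.+1) a = rshift 1 a by apply: val_inj.
by rewrite (unsplitK (inr _ : 'I_1 + 'I_k)).
Qed.

(* Main.v *)
(** The SVD gives [g_i^* M^(1/2) U_k c = sigma_k g_i^* g_k = 0] for [i < k],
    so [W c = 0]. Stacking a row of ones on top of [W] yields a square matrix
    [A] with [A c = (sum_j c_j) e_0], and Cramer's rule expresses the
    normalized [c_j] as the first-row cofactors of [A] divided by [det A]. *)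

Require Import Defs.
From HB Require Import structures.
From mathcomp Require Import all_boot all_order all_algebra.
From mathcomp Require Import reals complex.

Import Order.TTheory GRing.Theory Num.Theory.
Local Open Scope ring_scope.
Local Open Scope complex_scope.
Local Open Scope sesquilinear_scope.

Set Implicit Arguments.
Unset Strict Implicit.
Unset Printing Implicit Defensive.

(** Deleting row 0 removes the only place where [u] and [v] enter. This reconciles the zero row
    inside [Dvec] with the row of ones in [Dscal]. *)
Lemma eq_cofactor_row0 (A : comPzRingType) (k : nat) (W : 'M[A]_(k, k.+1))
    (u v : 'rV[A]_k.+1) (j : 'I_k.+1) :
  cofactor (col_mx u W : 'M_k.+1) ord0 j =
  cofactor (col_mx v W : 'M_k.+1) ord0 j.
Proof.
rewrite /cofactor; congr (_ * \det _); apply/matrixP=> a b; rewrite !mxE.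
have -> : lift (ord0 : 'I_k.+1) a = rshift 1 a by apply: val_inj.
by rewrite (unsplitK (inr _ : 'I_1 + 'I_k)).
Qed.

(** Cramer's rule without division: multiply [B *m c] = (u c) e_0 on the left by [\adj B], so that
    only column 0 of the adjugate survives. *)
Lemma cramer_col_mx_ker (A : comPzRingType) (k : nat) (W : 'M[A]_(k, k.+1))
    (u : 'rV[A]_k.+1) (c : 'cV[A]_k.+1) (j : 'I_k.+1) :
  W *m c = 0 ->
  \det (col_mx u W : 'M_k.+1) * c j 0 =
  cofactor (col_mx u W : 'M_k.+1) ord0 j * (u *m c) 0 0.
Proof.
move=> Wc0; set B := (col_mx u W : 'M_k.+1).
have Bc : B *m c = col_mx (u *m c) (0 : 'M_(k, 1)).
  by rewrite -Wc0; exact: (@mul_col_mx _ 1 k k.+1 1).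
have -> : \det B * c j 0 = ((\det B)%:M *m c) j 0 by rewrite mul_scalar_mx mxE.
rewrite -mul_adj_mx -mulmxA Bc mxE (bigD1 ord0) //= big1 ?addr0 => [|i].
  rewrite [\adj B j ord0]mxE; congr (_ * _).
  have -> : (ord0 : 'I_k.+1) = lshift k (ord0 : 'I_1) by apply: val_inj.
  exact: (@col_mxEu _ 1 k).
case: (unliftP ord0 i) => [i' -> _|->]; last by rewrite eqxx.
have -> : lift (ord0 : 'I_k.+1) i' = rshift 1 i' by apply: val_inj.
by rewrite (@col_mxEd _ 1 k) [(0 : 'cV_k) _ _]mxE mulr0.
Qed.

Lemma svd_mul_col (R : realType) (N p : nat) (A G : 'M[R[i]]_(N, p))
    (sigma : 'rV[R]_p) (H : 'M[R[i]]_p) (j : 'I_p) :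
  is_svd A G sigma H -> A *m col j H = (sigma 0 j)%:C *: col j G.
Proof.
case=> _ HH _ _ ->; rewrite colE -2!mulmxA [H ^t* *m _]mulmxA HH mul1mx -colE.
apply/colP=> r; rewrite [RHS]mxE mxE (bigD1 j) //= big1 ?addr0 => [|i ij].
  by rewrite !mxE eqxx mulrC.
by rewrite !mxE (negPf ij) rmorph0 mulr0.
Qed.

(** As [S] is hermitian, (S g_i)^* = g_i^* S; the entries become those of a matrix product to which
    the SVD applies. *)
Lemma proj_diff_mxE (R : realType) (N k n : nat) (S : 'M[R[i]]_N)
    (G : 'M[R[i]]_(N, k.+1)) (x : nat -> 'cV[R[i]]_N) :
  S ^t* = S ->
  proj_diff_mx S G x n =
  rowsub (widen_ord (leqnSn k)) (G ^t* *m (S *m fdiff_mx x n k)).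
Proof.
move=> SE; apply/matrixP=> i j; rewrite [LHS]mxE [RHS]mxE mulmxA.
rewrite -[in RHS]SE -map_mxM -trmx_mul [LHS]mxE [RHS]mxE.
apply: eq_bigr => r _; rewrite !mxE.
by congr (_ ^* * _); apply: eq_bigr => l _; rewrite !mxE.
Qed.

(** [K] stands for L^(-1/2), so [K *m col ord_max H] is the vector c of the method. *)
Lemma proj_diff_mx_mul_svd (R : realType) (N n k : nat)
    (x : nat -> 'cV[R[i]]_N) (S : 'M[R[i]]_N) (K : 'M[R[i]]_k.+1)
    (G : 'M[R[i]]_(N, k.+1)) (sigma : 'rV[R]_k.+1) (H : 'M[R[i]]_k.+1) :
  S ^t* = S -> is_svd (S *m fdiff_mx x n k *m K) G sigma H ->
  proj_diff_mx S G x n *m (K *m col ord_max H) = 0.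
Proof.
move=> SE svd; have [GG _ _ _ _] := svd.
rewrite proj_diff_mxE // mul_rowsub_mx -mulmxA [_ *m (K *m _)]mulmxA.
rewrite (svd_mul_col _ svd) -scalemxAr colE mulmxA GG -colE.
(* What remains is sigma_k e_k cut to its first k entries, and its only possibly nonzero entry has
   index k. *)
apply/colP=> i; rewrite !mxE -val_eqE /= ltn_eqF ?mulr0 //; exact: ltn_ord.
Qed.

Theorem theorem3 (R : realType) (N n k : nat) (x : nat -> 'cV[R[i]]_N)
    (M Mhalf : 'M[R[i]]_N) (L Lhalf : 'M[R[i]]_k.+1)
    (G : 'M[R[i]]_(N, k.+1)) (sigma : 'rV[R]_k.+1) (H : 'M[R[i]]_k.+1) :
  (1 <= k)%N -> (k.+1 <= N)%N ->
  hpd M -> is_hpd_sqrt M Mhalf ->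
  hpd L -> is_hpd_sqrt L Lhalf ->
  is_svd (Mhalf *m fdiff_mx x n k *m invmx Lhalf) G sigma H ->
  let c := invmx Lhalf *m col ord_max H in
  let W := proj_diff_mx Mhalf G x n in
  \sum_(j < k.+1) c j 0 != 0 ->
  Dscal W (fun=> 1) != 0 ->
  mpe_approx x n c = (Dscal W (fun=> 1))^-1 *: Dvec W (fun j => x (n + j)%N).
Proof.
move=> _ _ _ [[Mherm _] _] _ _ svd c W c_neq0 D_neq0.
have SE : Mhalf ^t* = Mhalf.
  by have /is_hermitianmxP := Mherm; rewrite expr0 scale1r => <-.
have Wc0 : W *m c = 0 := proj_diff_mx_mul_svd SE svd.
(* It suffices to match the coefficients of each x_(n+j). *)
rewrite /mpe_approx /Dvec scaler_sumr; apply: eq_bigr => j _.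
rewrite scalerA; congr (_ *: _).
have := cramer_col_mx_ker (\row__ 1) j Wc0.
rewrite (eq_cofactor_row0 _ _ 0) -/(Dscal W (fun=> 1)).
have -> : ((\row__ 1) *m c) 0 0 = \sum_(i < k.+1) c i 0.
  by rewrite mxE; apply: eq_bigr => i _; rewrite mxE mul1r.
(* After multiplication by D(1,...,1), both sides reduce to the cofactor. *)
move=> cramer; apply: (mulfI D_neq0).
by rewrite mulrA cramer mulfK // mulVKf.
Qed.
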